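(* Let $X$ be a Tychonoff space and let $\beta X$ be its Čech–Stone compactification. The following two conditions are equivalent: (A) $X$ has the projective Menger property (i.e. $X$ is projectively Menger); (B) player I has no winning strategy in the $z$-Porada game $zP(\beta X, \beta X\setminus X)$.
   Context: All spaces are Tychonoff (completely regular Hausdorff). $X$ is regarded as a subspace of its Čech–Stone compactification $\beta X$. A topological space $Y$ is Menger (has the Menger property) if for every sequence $(\mathscr{U}_n)_{n\in\omega}$ of open covers of $Y$ there is a sequence $(\mathscr{V}_n)_{n\in\omega}$ such that for every $n$, $\mathscr{V}_n$ is a finite subfamily of $\mathscr{U}_n$, and the family $\bigcup_{n\in\omega}\mathscr{V}_n$ covers $Y$. A space $X$ is projectively Menger if every separable metrizable continuous image of $X$ is Menger. A subset $A$ of a space $Z$ is a zero-set in $Z$ if there is a continuous map $f: Z\to[0,1]$ with $A=f^{-1}(0)$; in a compact space $Z$ the zero-sets are exactly the closed $G_\delta$-subsets. The $z$-Porada game. Let $Z$ be a compact space and $S\subseteq Z$ a subspace. The $z$-Porada game $zP(Z,S)$ on $Z$ with values in $S$ has $\omega$-many innings and is played alternately by players I and II. Put $V_{-1}=Z$. In inning $n\in\omega$, player I chooses a pair $(K_n,U_n)$, where $K_n$ is a nonempty zero-set in $Z$ with $K_n\subseteq S\cap V_{n-1}$, and $U_n$ is an open subset of $Z$ with $K_n\subseteq U_n\subseteq V_{n-1}$; player II responds with an open subset $V_n$ of $Z$ such that $K_n\subseteq V_n\subseteq U_n$. Player II wins the run if $\emptyset\neq\bigcap_{n\in\omega}U_n\;(=\bigcap_{n\in\omega}V_n)\subseteq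 S$; otherwise player I wins. A strategy for player I in $zP(Z,S)$ is a map $\sigma$ defined inductively: a tuple $(V_0,\ldots,V_{n-1})$ of nonempty open subsets of $Z$ is admissible if it is empty ($n=0$), or if for every $i\in\{0,\ldots,n-1\}$ one has $K_i\subseteq V_i\subseteq U_i$, where $(K_i,U_i)=\sigma(V_0,\ldots,V_{i-1})$ (with $(K_0,U_0)=\sigma(\emptyset)$). To each admissible tuple $(V_0,\ldots,V_{n-1})$, $n\in\omega$, $\sigma$ assigns a pair $\sigma(V_0,\ldots,V_{n-1})=(K_n,U_n)$ that is a legal move for player I, i.e. $K_n$ is a nonempty zero-set in $Z$ contained in $V_{n-1}\cap S$ and $U_n$ is an open subset of $V_{n-1}$ with $K_n\subseteq U_n$. (In particular, if $S$ contains no nonempty zero-set of $Z$, player I has no strategy.) The strategy $\sigma$ is winning if player I wins every run of the game in which she plays according to $\sigma$. *)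

(* Defs.v *)
From HB Require Import structures.
From mathcomp Require Import all_boot all_order all_algebra.
From mathcomp Require Import all_classical all_reals all_analysis.
Set Implicit Arguments.
Unset Strict Implicit.
Unset Printing Implicit Defensive.
Import Order.TTheory GRing.Theory Num.Theory.
Import numFieldTopology.Exports numFieldNormedType.Exports.
Local Open Scope classical_set_scope.
Local Open Scope ring_scope.

Definition tychonoff_space (X : topologicalType) : Prop :=
  completely_regular_space X /\ hausdorff_space X.

Definition open_cover (Y : topologicalType) (U : set (set Y)) : Prop :=
  U `<=` open /\ \bigcup_(O in U) O = [set: Y].

Definition menger (Y : topologicalType) : Prop :=
  forall U : nat -> set (set Y), (forall n, open_cover (U n)) ->
  exists V : nat -> set (set Y),
    (forall n, finite_set (V n) /\ V n `<=` U n) /\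
    \bigcup_(O in \bigcup_n V n) O = [set: Y].

Definition separable (Y : topologicalType) : Prop :=
  exists2 D : set Y, countable D & dense D.

(* A metrizable space with a chosen compatible metric is a [metricType];
   [menger] and [separable] only see its topology. *)
Definition projectively_menger (R : realType) (X : topologicalType) : Prop :=
  forall (Y : metricType R) (f : X -> Y),
    separable Y -> continuous f -> range f = [set: Y] -> menger Y.

(* The Cech-Stone compactification as the closure of the image of X under the
   evaluation map into the cube [0,1]^C(X,[0,1]). The cube is taken inside the
   product of copies of R, in which it is closed, so that the closure below
   is the same as in the cube. *)
Section stone_cech.
Context (R : realType) (X : topologicalType).

Definition unit_function : Type :=
  {f : X -> R | continuous f /\ range f `<=` `[0, 1]}.

Definition stone_cech_eval (x : X) : prod_topology (fun _ : unit_function => R) :=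
  fun f => sval f x.

Definition stone_cech : topologicalType := closure (range stone_cech_eval).

Definition stone_cech_embed (x : X) : stone_cech :=
  SigSub (mem_set (subset_closure (imageT stone_cech_eval x))).

End stone_cech.

Section stone_cech_theory.
Context (R : realType) (X : topologicalType).
Local Notation I := {classic (unit_function R X)}.
Local Notation P := (prod_topology (fun _ : unit_function R X => R)).

Let ev (f : unit_function R X) (p : P) : R := p f.

Let ev_cont f : continuous (ev f).
Proof. exact: (@proj_continuous I (fun=> R) f). Qed.

Lemma stone_cech_hausdorff : hausdorff_space (stone_cech R X).
Proof.
move=> p q pq; apply: val_inj.
apply: (@hausdorff_product I (fun=> R) (fun=> @Rhausdorff R)).
move=> A B nA nB.
have cv : continuous (set_val : stone_cech R X -> P) by exact: initial_continuous.
have [z [Az Bz]] := pq _ _ (cv p A nA) (cv q B nB).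
by exists (val z).
Qed.

Let cube : set P := [set p | forall f, `[0, 1]%classic (p f)].

Let cube_compact : compact cube.
Proof. exact: (@tychonoff I (fun=> R) (fun=> `[0,1]%classic) (fun=> @segment_compact R 0 1)). Qed.

Let sub_cube : closure (range (@stone_cech_eval R X)) `<=` cube.
Proof.
have hP : hausdorff_space P.
  exact: (@hausdorff_product I (fun=> R) (fun=> @Rhausdorff R)).
rewrite [X in _ `<=` X](closure_id _).1; last exact: compact_closed cube_compact.
apply: closureS => _ [x _ <-] f; rewrite /stone_cech_eval.
by case: f => f [cf rf] /=; apply: rf; exists x.
Qed.

Lemma stone_cech_compact : compact [set: stone_cech R X].
Proof.
have cA : compact (closure (range (@stone_cech_eval R X))).
  apply: subclosed_compact cube_compact sub_cube; exact: closed_closure.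
move=> F FF _.
pose G := (set_val : stone_cech R X -> P) @ F.
have [|p [Ap cp]] := cA G _.
  by apply: (@filterS _ F _ setT); [move=> x _; exact: (set_mem (valP x))|exact: filterT].
exists (SigSub (mem_set Ap)); split => // U V FU [_ [[W oW <-] /= Wp] WV].
have GU : G (set_val @` U) by rewrite /G /=; apply: (@filterS _ F _ U) => // u Uu; exists u.
have nW : nbhs p W by apply: open_nbhs_nbhs; split => //; exact: Wp.
have [z [[u Uu <-] Wz]] := cp _ _ GU nW.
by exists u; split => //; exact: WV.
Qed.

Lemma stone_cech_embed_continuous : continuous (@stone_cech_embed R X).
Proof.
move=> x U [_ [[W oW <-] /= Wx] WU].
suff : continuous (@stone_cech_eval R X).
  move=> /(_ x W (open_nbhs_nbhs (conj oW Wx))) nWx.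
  by apply: (@filterS _ (nbhs x) _ (@stone_cech_eval R X @^-1` W)) => // y Wy; exact: WU.
move=> y; apply/(@cvg_sup _ (unit_function R X)) => f.
move=> V [_ [[B oB <-] /= By] BV].
case: (svalP f) => cf _.
have nB := cf y B (open_nbhs_nbhs (conj oB By)).
by apply: (@filterS _ (nbhs y) _ (sval f @^-1` B)) => // z Bz; exact: BV.
Qed.

Lemma stone_cech_dense : dense (range (@stone_cech_embed R X)).
Proof.
move=> O [p Op] [W oW WO]; have Wp : W (val p) by rewrite -WO in Op.
have nW : nbhs (val p : P) W by apply: open_nbhs_nbhs; split.
have [_ [[x _ <-] Wx]] := set_mem (valP p) W nW.
by exists (stone_cech_embed R x); split; [rewrite -WO|exists x].
Qed.

Lemma stone_cech_embed_nbhs x (A : set X) : completely_regular_space X ->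
  nbhs x A -> exists2 U : set (stone_cech R X),
    nbhs (stone_cech_embed R x) U & @stone_cech_embed R X @^-1` U `<=` A.
Proof.
move=> crX; rewrite nbhsE => - [] O [oO Ox] OA.
have cO : closed (~` O) by exact: open_closedC.
have [f [cf rf f0 f1]] := (@uniform_separatorP X R _ _).1 (crX x (~` O) cO (fun h => h Ox)).
pose uf : unit_function R X := exist _ f (conj cf rf).
exists (@set_val P _ @^-1` (ev uf @^-1` [set r | r < 1])).
  have cv : continuous (set_val : stone_cech R X -> P) by exact: initial_continuous.
  apply: cv; apply: ev_cont; rewrite /ev/=.
  have fx0 : f x = 0 by apply: f0; exists x.
  apply: open_nbhs_nbhs; split; first exact: open_lt.
  by change (f x < 1); rewrite fx0.
move=> y fy; apply: OA; change (is_true (f y < 1)) in fy.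
apply: contrapT => nOy.
by have fy1 : f y = 1 := f1 _ (ex_intro2 _ _ y nOy erefl); move: fy; rewrite fy1 ltxx.
Qed.

Lemma stone_cech_embed_inj : tychonoff_space X -> injective (@stone_cech_embed R X).
Proof.
move=> [crX hX] x y exy; apply: hX => A B nA nB.
have [U nU UA] := stone_cech_embed_nbhs crX nA.
exists y; split; last exact: nbhs_singleton.
by apply: UA; rewrite /= -exy; exact: nbhs_singleton.
Qed.

Lemma stone_cech_extension (f : X -> R) : continuous f -> range f `<=` `[0, 1] ->
  exists g : stone_cech R X -> R,
    [/\ continuous g, range g `<=` `[0, 1] & g \o @stone_cech_embed R X = f].
Proof.
move=> cf rf; pose uf : unit_function R X := exist _ f (conj cf rf).
exists (fun p => ev uf (val p)); split => //.
- have cv : continuous (set_val : stone_cech R X -> P) by exact: initial_continuous.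
  by move=> p; apply: continuous_comp; [exact: cv|exact: ev_cont].
- by move=> _ [p _ <-]; exact: (sub_cube (set_mem (valP p))).
Qed.
End stone_cech_theory.

Definition zero_set (R : realType) (Z : topologicalType) (A : set Z) : Prop :=
  exists f : Z -> R,
    [/\ continuous f, range f `<=` `[0, 1] & A = f @^-1` [set 0]].

Section zPorada_game.
Context (R : realType) (Z : topologicalType) (S : set Z).
Implicit Types (KU : set Z * set Z) (s : seq (set Z)).

(* W is the previous move of player II. *)
Definition zPorada_legalI (W : set Z) KU : Prop :=
  [/\ KU.1 !=set0, zero_set R KU.1, KU.1 `<=` S `&` W, open KU.2
    & KU.1 `<=` KU.2 /\ KU.2 `<=` W].

Definition zPorada_legalII KU (V : set Z) : Prop :=
  [/\ open V, KU.1 `<=` V & V `<=` KU.2].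

Definition zPorada_winsII (U : nat -> set Z) : Prop :=
  \bigcap_n U n !=set0 /\ \bigcap_n U n `<=` S.

(* A strategy is represented by a function on all finite sequences; its values
   on sequences that are not admissible are irrelevant. *)
Implicit Type sigma : seq (set Z) -> set Z * set Z.

Definition zPorada_admissible sigma s : Prop :=
  forall i, (i < size s)%N ->
    nth setT s i !=set0 /\ zPorada_legalII (sigma (take i s)) (nth setT s i).

Definition zPorada_strategy sigma : Prop :=
  forall s, zPorada_admissible sigma s -> zPorada_legalI (last setT s) (sigma s).

(* [V] is the sequence of moves of player II in an infinite run in which
   player I follows [sigma]; the n-th move of player I is then
   [sigma (mkseq V n)]. *)
Definition zPorada_run sigma (V : nat -> set Z) : Prop :=
  forall n, zPorada_admissible sigma (mkseq V n).

Definition zPorada_winning_strategy sigma : Prop :=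
  zPorada_strategy sigma /\
  forall V : nat -> set Z, zPorada_run sigma V ->
    ~ zPorada_winsII (fun n => (sigma (mkseq V n)).2).

End zPorada_game.

(* Main.v *)
Require Import Defs.
From HB Require Import structures.
From mathcomp Require Import all_boot all_order all_algebra.
From mathcomp Require Import all_classical all_reals all_analysis.
From mathcomp Require Import lra.
Local Open Scope classical_set_scope.

(* If X is projectively Menger and sigma is a strategy for player I, let player
   II answer K = h^-1(0) only with sets of the form {h < 1/(k+2)}. The resulting
   tree of positions is countable, so all the functions h factor, on X, through
   a single separable metrizable image Y, which is Menger. The complements of
   II's answers give a tree of open covers of Y, and Hurewicz's theorem (a Menger
   space does not admit a winning strategy for the cover-giving player of the
   Menger game) yields a branch whose answers miss X.

   Conversely, failure of the Menger property of an image is witnessed by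
   continuous g n k : X -> [0,1], extended to the compactification. Player I
   plays the zero-set of all g n k (k arbitrary) together with the g i k
   (i < n, k <= b i), where b i is read off, by compactness, from II's answers. *)

Set Implicit Arguments.
Unset Strict Implicit.
Unset Printing Implicit Defensive.
Import Order.TTheory GRing.Theory Num.Theory.
Import numFieldTopology.Exports numFieldNormedType.Exports.
Local Open Scope ring_scope.

(** * Decreasing closed sets in a compact space *)

Section compact_nonincreasing.
Context (Z : topologicalType) (C : nat -> set Z).
Hypothesis Zcompact : compact [set: Z].
Hypothesis Cclosed : forall n, closed (C n).
Hypothesis CS : forall n, C n.+1 `<=` C n.

(** Otherwise the sets [C n] minus [V] form a base of a proper filter, and a cluster point lies in
    every [C n] but not in [V]. *)
Lemma compact_bigcap_sub_open (V : set Z) :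
  open V -> \bigcap_n C n `<=` V -> exists n, C n `<=` V.
Proof.
move=> oV CV; apply: contrapT => /forallNP nCV.
have CmS m n : (m <= n)%N -> C n `<=` C m.
  move=> /subnK <-; elim: (n - m)%N => [|k IH]; first by rewrite add0n.
  by rewrite addSn; apply: subset_trans IH; exact: CS.
pose F := filter_from [set: nat] (fun n => C n `\` V).
have FF : ProperFilter F.
  apply: filter_from_proper; last first.
    by move=> n _; have /existsNP[z /not_implyP[Cz Vz]] := nCV n; exists z.
  apply: filter_from_filter => [|m n _ _]; first by exists 0%N.
  exists (maxn m n) => // z [Cz Vz].
  by split; split=> //; apply: CmS Cz; rewrite ?leq_maxl ?leq_maxr.
have [p [_ Fp]] := Zcompact FF (filterT : F setT).
have CVp n : (C n `\` V) p.
  have cl : closed (C n `\` V) by apply: closedI => //; exact: open_closedC.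
  by apply: cl => B pB; apply: Fp => //; exists n.
by have [_] := CVp 0%N; apply; apply: CV => n _; have [] := CVp n.
Qed.

Lemma compact_bigcap_nonempty :
  (forall n, C n !=set0) -> \bigcap_n C n !=set0.
Proof.
move=> C0; apply/set0P/negP => /eqP CE0.
have [|n Cn0] := @compact_bigcap_sub_open set0 open0; first by rewrite CE0.
by have [z /Cn0] := C0 n.
Qed.

End compact_nonincreasing.

(** * A metric for sequences in [0,1], and countable intersections of zero-sets *)

Section sup_distance.
Context (R : realType).
Implicit Types a b c : nat -> R.

Definition bounded01 a := forall k, 0 <= a k <= 1.

(* Induces the product topology on [0,1]^nat. *)
Definition wdist a b := sup (range (fun k => `|a k - b k| / k.+1%:R)).

Lemma wdist_le a b r : (forall k, `|a k - b k| / k.+1%:R <= r) -> wdist a b <= r.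
Proof.
move=> abr; apply: ge_sup => [|_ [k _ <-]//].
by exists (`|a 0%N - b 0%N| / 1); exists 0%N.
Qed.

Lemma dist01 a b k : bounded01 a -> bounded01 b -> `|a k - b k| <= 1.
Proof.
move=> /(_ k)/andP[a0 a1] /(_ k)/andP[b0 b1].
by rewrite ler_norml; apply/andP; split; lra.
Qed.

Lemma wdist_ge a b k : bounded01 a -> bounded01 b ->
  `|a k - b k| / k.+1%:R <= wdist a b.
Proof.
move=> a01 b01; apply: ub_le_sup; last by exists k.
exists 1 => _ [i _ <-]; rewrite ler_pdivrMr ?ltr0n// mul1r.
by apply: le_trans (dist01 i a01 b01) _; rewrite ler1n.
Qed.

Lemma wdistxx a : wdist a a = 0.
Proof.
rewrite /wdist (_ : (fun k => _) = cst 0); last first.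
  by apply/funext => k /=; rewrite subrr normr0 mul0r.
by rewrite set_cst ifF ?sup1//; apply/eqP => /seteqP[/(_ 0%N Logic.I)].
Qed.

Lemma wdist_eq0 a b : bounded01 a -> bounded01 b -> wdist a b = 0 -> a = b.
Proof.
move=> a01 b01 ab0; apply/funext => k; apply/eqP.
rewrite -subr_eq0 -normr_le0; have := wdist_ge k a01 b01.
by rewrite ab0 ler_pdivrMr ?ltr0n// mul0r.
Qed.

Lemma wdistC a b : wdist a b = wdist b a.
Proof.
by rewrite /wdist; congr (sup _); apply: eq_imagel => k _; rewrite distrC.
Qed.

Lemma wdist_triangle b a c : bounded01 a -> bounded01 b -> bounded01 c ->
  wdist a c <= wdist a b + wdist b c.
Proof.
move=> a01 b01 c01; apply: wdist_le => k.
apply: (le_trans _ (lerD (wdist_ge k a01 b01) (wdist_ge k b01 c01))).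
by rewrite -mulrDl ler_pM2r ?invr_gt0 ?ltr0n// ler_distD.
Qed.

(** The weight makes every coordinate from [n] on contribute at most 1/(n+1), so only the first [n]
    need control. *)
Lemma wdist_truncate a b n r : bounded01 a -> bounded01 b ->
  n.+1%:R^-1 <= r -> (forall k, (k < n)%N -> `|a k - b k| <= r) ->
  wdist a b <= r.
Proof.
move=> a01 b01 nr abr; have r0 : 0 <= r by apply: (le_trans _ nr); rewrite invr_ge0.
apply: wdist_le => k; have [kn|nk] := ltnP k n.
  rewrite ler_pdivrMr ?ltr0n//; apply: le_trans (abr _ kn) _.
  by rewrite ler_peMr// ler1n.
apply: (le_trans _ nr); rewrite -[leRHS]mul1r.
apply: ler_pM; rewrite ?normr_ge0 ?invr_ge0 ?ler0n ?dist01//.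
by rewrite lef_pV2 ?posrE ?ltr0n// ler_nat.
Qed.

Lemma near_wdist (T : topologicalType) (u : T -> nat -> R) (x : T) (e : R) :
  (forall y, bounded01 (u y)) -> (forall k, {for x, continuous (u^~ k)}) ->
  0 < e -> \forall y \near x, wdist (u x) (u y) < e.
Proof.
move=> u01 cu e0; have e20 : 0 < e / 2 by rewrite divr_gt0.
have [n ne] : exists n, n.+1%:R^-1 <= e / 2.
  have [n _ /(_ n (leqnn n)) ne] := near_infty_natSinv_lt (PosNum e20).
  by exists n; exact/ltW.
have near_lt m : \forall y \near x, forall k, (k < m)%N -> `|u x k - u y k| <= e / 2.
  elim: m => [|m IH]; first exact: nearW.
  have um : \forall y \near x, `|u x m - u y m| <= e / 2.
    have /cvgrPdist_le := cu m.
    by apply.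
  near=> y => k; rewrite ltnS leq_eqVlt => /predU1P[->|km]; first by near: y.
  by move: k km; near: y.
near=> y; apply: (@le_lt_trans _ _ (e / 2)); last by lra.
apply: (wdist_truncate _ _ ne) => //.
by near: y; exact: near_lt.
Unshelve. all: by end_near. Qed.

End sup_distance.

(** The witness is the distance of [u z] to the zero sequence: continuous by the triangle
    inequality, and zero only when every coordinate is. *)
Lemma zero_set_bigcap (R : realType) (Z : topologicalType) (u : Z -> nat -> R) :
  (forall z, bounded01 (u z)) -> (forall k, continuous (u^~ k)) ->
  zero_set R [set z | forall k, u z k = 0].
Proof.
move=> u01 cu; have c01 : bounded01 (fun=> 0 : R) by move=> k; rewrite lexx ler01.
have w0 z : 0 <= wdist (u z) (fun=> 0).
  by apply: (le_trans _ (wdist_ge 0%N (u01 z) c01)); rewrite divr_ge0.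
exists (fun z => wdist (u z) (fun=> 0)); split.
- move=> x; apply/cvgrPdist_lt => e e0.
  have uxe := near_wdist (u01 : forall y, _) (fun k => cu k x) e0.
  apply: filterS uxe => y xye; apply: le_lt_trans xye.
  have xy := wdist_triangle (u01 x) (u01 y) c01.
  have yx := wdist_triangle (u01 y) (u01 x) c01.
  by rewrite (wdistC (u y) (u x)) in yx; rewrite ler_norml; apply/andP; split; lra.
- move=> _ [z _ <-] /=; rewrite in_itv/= w0/=; apply: wdist_le => k.
  rewrite ler_pdivrMr ?ltr0n// mul1r (le_trans (dist01 k (u01 z) c01))//.
  by rewrite ler1n.
- apply/seteqP; split=> z /= => [uz|/(wdist_eq0 (u01 z) c01) -> //].
  by rewrite (_ : u z = (fun=> 0)) ?wdistxx//; exact/funext.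
Qed.

Lemma continuous_mdist_bound (R : realType) (Y : metricType R) (f : Y -> R) (c : R) :
  0 < c -> (forall y z, `|f y - f z| <= c * mdist y z) -> continuous f.
Proof.
move=> c0 fc y; apply/cvgrPdist_lt => e e0.
apply: filterS (nbhsx_ballx y (e / c) (divr_gt0 e0 c0)) => z.
by rewrite ballEmdist/= ltr_pdivlMr// mulrC; exact: le_lt_trans.
Qed.

Lemma dense_mdist (R : realType) (Y : metricType R) (D : set Y) :
  (forall y e, 0 < e -> exists2 z, D z & mdist y z < e) -> dense D.
Proof.
move=> Dy O [y Oy] oO; have : nbhs y O by apply: open_nbhs_nbhs.
rewrite -metricType_numDomainType.filter_from_mdist_nbhs => -[e /= e0 yO].
by have [z Dz yz] := Dy y e e0; exists z; split => //; exact: yO.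
Qed.

(** * The separable metric image given by countably many functions *)

Section metric_image.
Context (R : realType) (X : topologicalType) (g : nat -> unit_function R X).

Definition coordinates (x : X) : nat -> R := fun k => sval (g k) x.

Definition metric_image : Type := range coordinates.

Definition to_image (x : X) : metric_image :=
  SigSub (mem_set (imageT coordinates x)).

Definition point_coordinates (y : metric_image) : nat -> R := val y.

Lemma to_image_surj y : exists x, to_image x = y.
Proof. by case: y => y yP; have [x _ xy] := set_mem yP; exists x; exact: val_inj. Qed.

Lemma coordinates01 x : bounded01 (coordinates x).
Proof.
move=> k; rewrite /coordinates; case: (g k) => f [cf rf] /=.
by have /= := rf (f x) (imageT f x); rewrite in_itv.
Qed.

Lemma point_coordinates01 y : bounded01 (point_coordinates y).
Proof. by have [x <-] := to_image_surj y; exact: coordinates01. Qed.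

HB.instance Definition _ := Choice.copy metric_image (range coordinates).

Definition image_dist (y z : metric_image) : R :=
  wdist (point_coordinates y) (point_coordinates z).

Let image_dist_xx y : image_dist y y = 0.
Proof. exact: wdistxx. Qed.

Let image_dist_eq0 y z : image_dist y z = 0 -> y = z.
Proof.
move=> yz; apply: val_inj.
exact: (wdist_eq0 (point_coordinates01 y) (point_coordinates01 z)).
Qed.

Let image_distC y z : image_dist y z = image_dist z y.
Proof. exact: wdistC. Qed.

Let image_dist_triangle z x y : image_dist x y <= image_dist x z + image_dist z y.
Proof. by apply: wdist_triangle; exact: point_coordinates01. Qed.

HB.instance Definition _ := @isMetric.Build R metric_image image_dist
  image_dist_xx image_dist_eq0 image_distC image_dist_triangle.

Lemma to_image_continuous : continuous to_image.
Proof.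
move=> x; apply/metricType_numDomainType.cvgrPdist_lt => e e0.
apply: (near_wdist coordinates01 _ e0) => k.
by rewrite /coordinates; case: (g k) => f [cf rf] /=; exact: cf.
Qed.

Lemma point_coordinates_continuous k : continuous (point_coordinates^~ k).
Proof.
apply: (@continuous_mdist_bound R metric_image _ k.+1%:R) => [|y z].
  by rewrite ltr0n.
rewrite mulrC -ler_pdivrMr ?ltr0n//.
exact: (wdist_ge k (point_coordinates01 y) (point_coordinates01 z)).
Qed.

(** Rational grid points may lie outside the image, so the countable dense set takes one image point
    from each grid cell that meets the image; empty cells yield [y0]. *)
Lemma metric_image_separable : separable metric_image.
Proof.
have [[y0 _]|] := pselect (exists y : metric_image, True); last first.
  move=> /forallNP Y0; exists set0; first exact: countable0.
  by move=> O [y _]; have := Y0 y.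
pose grid (mq : nat * seq nat) : set metric_image :=
  [set y | forall k, (k < mq.1)%N ->
    `|point_coordinates y k - (nth 0%N mq.2 k)%:R / mq.1.+1%:R| <= mq.1.+1%:R^-1].
exists (range (fun mq => xget y0 (grid mq))).
  exact: (sub_countable (card_image_le _ _) (countableP _)).
apply: (@dense_mdist R metric_image) => y e e0.
(* With 1/(m+1) < e/4, two points of one cell differ by at most 2 (e/4) in the first [m]
   coordinates. *)
have e40 : 0 < e / 4 by rewrite divr_gt0.
have [m _ /(_ m (leqnn m)) /= me] := near_infty_natSinv_lt (PosNum e40).
have m0 : 0 < m.+1%:R :> R by rewrite ltr0n.
pose q := mkseq (fun k => Num.truncn (point_coordinates y k * m.+1%:R)) m.
have yq : grid (m, q) y.
  move=> k /= km; rewrite nth_mkseq//.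
  have /andP[y_ge0 _] := point_coordinates01 y k.
  have /andP[ylo yhi] := truncn_itv (mulr_ge0 y_ge0 (ltW m0)).
  rewrite -[(Num.truncn _).+1%:R]natr1 in yhi.
  rewrite -[X in `|X - _|](mulfK (lt0r_neq0 m0)) -mulrBl normrM normfV (gtr0_norm m0).
  by rewrite ler_piMl ?invr_ge0 ?(ltW m0)// ler_norml; apply/andP; split; lra.
pose z := xget y0 (grid (m, q)).
have zq : grid (m, q) z := xgetPex y0 (ex_intro _ y yq).
exists z; first by exists (m, q).
change (is_true (wdist (point_coordinates y) (point_coordinates z) < e)).
apply: (@le_lt_trans _ _ (2 * (e / 4))); last by lra.
apply: (wdist_truncate (n := m)); try exact: point_coordinates01.
  by rewrite (le_trans (ltW me))// ler_peMl ?ltW// ltr1n.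
move=> k km; have := yq k km; have := zq k km => /=.
rewrite (distrC (point_coordinates z k)) => zk yk.
apply: le_trans (ler_distD _ _ _) _; last apply: le_trans (lerD yk zk) _.
by rewrite mulr_natl mulr2n lerD// ltW.
Qed.

End metric_image.

Lemma projectively_menger_metric_image (R : realType) (X : topologicalType)
    (g : nat -> unit_function R X) :
  projectively_menger R X -> menger (metric_image g).
Proof.
move=> /(_ (metric_image g) (to_image g)); apply.
- exact: metric_image_separable.
- exact: to_image_continuous.
- by apply/seteqP; split=> // y _; have [x <-] := to_image_surj y; exists x.
Qed.

Lemma near_all (T : topologicalType) (I : eqType) (A : I -> set T) (s : seq I) (y : T) :
  (forall i, nbhs y (A i)) -> \forall z \near y, forall i, i \in s -> A i z.
Proof.
move=> yA; elim: s => [|i s IH]; first exact: nearW.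
apply: filterS2 (yA i) IH => z Aiz sz j.
by rewrite in_cons => /predU1P[->|/sz].
Qed.

(** * Hurewicz's theorem on the Menger game *)

Section menger_branch.
Context (Y : topologicalType) (U : seq nat -> set Y).
Hypothesis Ymenger : menger Y.
Hypothesis Uopen : forall s, open (U s).
Hypothesis Uhomo : forall s j k, (j <= k)%N -> U (rcons s j) `<=` U (rcons s k).
Hypothesis Ucover : forall s y, exists k, U (rcons s k) y.

(** Collects what is covered anywhere along [s]; unlike [U], it only grows when the position is
    extended. *)
Let V s := \bigcup_(n in [set n | (n < size s)%N]) U (take n.+1 s).

Let Vopen s : open (V s).
Proof. by apply: bigcup_open. Qed.

Let V_rcons s k : V s `<=` V (rcons s k).
Proof.
move=> y [n /= ns Uy]; exists n; first by rewrite /= size_rcons ltnW.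
by rewrite -cats1 takel_cat.
Qed.

Let U_sub_V s k : U (rcons s k) `<=` V (rcons s k).
Proof.
by move=> y Uy; exists (size s); rewrite /= ?take_oversize ?size_rcons.
Qed.

Let Vhomo s j k : (j <= k)%N -> V (rcons s j) `<=` V (rcons s k).
Proof.
move=> jk y [n /=]; rewrite size_rcons ltnS leq_eqVlt => /predU1P[->|ns].
  rewrite take_oversize ?size_rcons// => Uy.
  by apply: U_sub_V; exact: Uhomo Uy.
rewrite -cats1 takel_cat// => Uy; exists n; first by rewrite /= size_rcons ltnW.
by rewrite -cats1 takel_cat.
Qed.

(* Excluding more sequences enlarges [tail n L], so a finite selection from the
   cover by the interiors of the sets [tail n L] amounts to a single finite
   list [L], which a branch can avoid. *)
Let tail n (L : seq (seq nat)) : set Y :=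
  [set z | forall s, size s = n -> s \notin L -> V s z].

(** Induction on [n]. Children of an unlisted [s] inherit [V s]. For each of the finitely many
    listed [s], monotonicity leaves only the children below some [N s] to exclude, where
    [U (rcons s (N s))] contains [y]. *)
Let near_tail n (y : Y) : exists L, nbhs y (tail n L).
Proof.
elim: n => [|n [L yL]].
  (* [V [::]] is empty, so the empty sequence has to be excluded. *)
  by exists [:: [::]]; apply: nearW => z s /size0nil ->; rewrite inE.
have [N yN] := choice (fun s => Ucover s y).
exists [seq rcons s k | s <- L, k <- iota 0 (N s)].
have yLN : \forall z \near y, forall s, s \in L -> V (rcons s (N s)) z.
  by apply: near_all => s; apply: open_nbhs_nbhs; split=> //; exact: U_sub_V.
apply: filterS2 yL yLN => z zL zLN t.
case/lastP: t => // s k; rewrite size_rcons => -[sn] skL.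
have [sL|sL] := boolP (s \in L); last by apply: V_rcons; exact: zL.
apply: (Vhomo _ (zLN s sL)); rewrite leqNgt; apply: contra skL => kN.
by apply/allpairsPdep; exists s, k; rewrite mem_iota add0n.
Qed.

(** The Menger property yields a list [L n] of sequences for each [n], the sets [tail n.+1 (L n)]
    covering [Y]. Along a branch whose initial segment of length n+1 avoids [L n], every point is
    covered at some stage. *)
Lemma menger_branch : exists b : nat -> nat, forall y, exists n, U (mkseq b n.+1) y.
Proof.
pose W n : set (set Y) := range (fun L => (tail n.+1 L)^°).
have Wcover n : open_cover (W n).
  split; first by move=> _ [L _ <-]; exact: open_interior.
  apply/seteqP; split=> // y _; have [L yL] := near_tail n.+1 y.
  by exists (tail n.+1 L)^°; [exists L|].
have [F [Ffin Fcover]] := Ymenger Wcover.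
have tailS n L1 L2 : {subset L1 <= L2} -> tail n L1 `<=` tail n L2.
  by move=> L12 z zL s sn sL2; apply: zL => //; apply: contra sL2 => /L12.
have FL n : exists L, \bigcup_(O in F n) O `<=` tail n.+1 L.
  have [finF FW] := Ffin n; move: finF FW => /finite_seqP[l ->].
  elim: l => [|O l IH] lW; first by exists [::] => z [].
  have [L lL] : exists L, \bigcup_(O in [set` l]) O `<=` tail n.+1 L.
    by apply: IH => P /= lP; apply: lW; rewrite /= in_cons lP orbT.
  have [L' _ OE] : W n O by apply: lW; rewrite /= mem_head.
  exists (L' ++ L) => z [P /=]; rewrite in_cons => /predU1P[->|lP] Pz.
    apply: (@tailS _ L'); first by move=> s; rewrite mem_cat => ->.
    by apply: interior_subset; rewrite OE.
  apply: (@tailS _ L); first by move=> s; rewrite mem_cat orbC => ->.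
  by apply: lL; exists P.
have [L FsubL] := choice FL.
have nextk s : exists k : nat, rcons s k \notin L (size s).
  (* This index exceeds the last entry of every listed sequence. *)
  exists (\max_(t <- L (size s)) last 0%N t).+1; apply/negP => skL.
  have := @leq_bigmax_seq _ (L (size s)) xpredT (last 0%N) _ skL isT.
  by rewrite last_rcons ltnn.
have [k kL] := choice nextk.
pose branch := fix branch n :=
  if n is m.+1 then rcons (branch m) (k (branch m)) else [::].
pose b n := k (branch n).
have branchE n : mkseq b n = branch n by elim: n => // n IH; rewrite mkseqS IH.
exists b => y.
have [G [n _ Fn] Oy] : (\bigcup_(O in \bigcup_n F n) O) y by rewrite Fcover.
have tail_y : tail n.+1 (L n) y by apply: FsubL; exists G.
have [|m] := tail_y (mkseq b n.+1) (size_mkseq _ _).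
  rewrite mkseqS branchE; have := kL (branch n).
  by rewrite -[X in size X]branchE size_mkseq.
rewrite /mkset size_mkseq => mn Uy; exists m.
suff -> : mkseq b m.+1 = take m.+1 (mkseq b n.+1) by [].
by rewrite -map_take take_iota (minn_idPl mn).
Qed.

End menger_branch.

Lemma open_superlevel (R : realType) (T : topologicalType) (f : T -> R) (r : R) :
  continuous f -> open [set y | r < f y].
Proof.
move=> cf; apply: (@open_comp _ _ f [set x | r < x]) => [y _|].
  exact: cf.
exact: open_gt.
Qed.

(** * Positions of the game and normalised zero-set functions *)

Section player_one.
Context (R : realType) (Z : topologicalType).
Implicit Types (K U : set Z) (s : seq (set Z)) (sigma : seq (set Z) -> set Z * set Z).

Lemma zPorada_admissible_rcons sigma s V :
  zPorada_admissible sigma (rcons s V) <->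
  [/\ zPorada_admissible sigma s, V !=set0 & zPorada_legalII (sigma s) V].
Proof.
split=> [adm|[adm V0 legV] i].
  have [] := adm (size s); rewrite ?size_rcons// nth_rcons ltnn eqxx.
  rewrite -cats1 take_cat ltnn subnn take0 cats0 => V0 legV; split=> // i si.
  have [] := adm i; first by rewrite size_rcons ltnW.
  by rewrite nth_rcons si -cats1 takel_cat// ltnW.
rewrite size_rcons ltnS leq_eqVlt => /predU1P[->|si].
  by rewrite nth_rcons ltnn eqxx -cats1 take_cat ltnn subnn take0 cats0.
by rewrite nth_rcons si -cats1 takel_cat ?(ltnW si)//; exact: adm.
Qed.

Lemma zPorada_runS sigma (V : nat -> set Z) :
  (forall n, V n !=set0 /\ zPorada_legalII (sigma (mkseq V n)) (V n)) ->
  zPorada_run sigma V.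
Proof.
move=> sV; elim=> [//|n IH]; rewrite mkseqS.
by apply/zPorada_admissible_rcons; have [] := sV n.
Qed.

(** By compactness some sublevel set f <= 1/(n+1) lies in [U]; scaling [f] by n+1 and truncating at
    1 moves this threshold to 1. *)
Lemma zero_set_sub_open K U : compact [set: Z] -> zero_set R K -> open U ->
  K `<=` U -> exists h : Z -> R, [/\ continuous h, range h `<=` `[0, 1],
    K = h @^-1` [set 0] & forall z, h z < 1 -> U z].
Proof.
move=> cZ [f [cf rf KE]] oU KU.
have f01 z : 0 <= f z <= 1 by have /= := rf _ (imageT f z); rewrite in_itv.
have [n nU] : exists n, f @^-1` [set r | r <= n.+1%:R^-1] `<=` U.
  apply: compact_bigcap_sub_open => //.
  - by move=> n; apply: closed_comp => [z _|]; [exact: cf|exact: closed_le].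
  - by move=> n z /= /le_trans; apply; rewrite lef_pV2 ?posrE ?ltr0n// ler_nat.
  - apply: subset_trans KU => z fz; rewrite KE /=; apply/eqP.
    have /andP[f0 _] := f01 z; rewrite eq_le f0 andbT leNgt; apply/negP => fz0.
    have [n _ /(_ n (leqnn n)) /=] := near_infty_natSinv_lt (PosNum fz0).
    by rewrite ltNge (fz n I).
have n0 : 0 < n.+1%:R :> R by rewrite ltr0n.
exists (fun z => Num.min 1 (f z * n.+1%:R)); split.
- move=> z; apply: (@continuous_min R Z (cst 1) (fun z => f z * _)).
    exact: cst_continuous.
  by apply: cvgM; [exact: cf|exact: cvg_cst].
- move=> _ [z _ <-] /=; rewrite in_itv/= ge_min lexx/= le_min ler01/=.
  by have /andP[f0 _] := f01 z; rewrite mulr_ge0.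
- rewrite KE; apply/seteqP; split=> z /=; first by move=> ->; rewrite mul0r min_r.
  rewrite /Num.min; case: ifPn; first by move=> _ /eqP; rewrite oner_eq0.
  by move=> _ /eqP; rewrite mulf_eq0 pnatr_eq0 orbF => /eqP.
- move=> z; rewrite gt_min ltxx/= -ltr_pdivlMr// mul1r => /ltW; exact: nU.
Qed.

End player_one.

(** * Defeating a strategy when X is projectively Menger *)

Section menger_beats_strategy.
Context (R : realType) (X : topologicalType).
Local Notation Z := (stone_cech R X).
Local Notation e := (@stone_cech_embed R X).
Local Notation S := ([set: Z] `\` range e).
Context (sigma : seq (set Z) -> set Z * set Z).
Hypothesis strat : zPorada_strategy R S sigma.
Hypothesis pmX : projectively_menger R X.

Let Zcompact := @stone_cech_compact R X.

(** Stated for every pair so that [h] can be chosen once for all; a pair that is never a legal move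
    gets the constant 0. *)
Let scale (KU : set Z * set Z) : exists h : Z -> R,
  [/\ continuous h, range h `<=` `[0, 1] & forall W, zPorada_legalI R S W KU ->
    KU.1 = h @^-1` [set 0] /\ forall z, h z < 1 -> KU.2 z].
Proof.
have [[W]|nleg] := pselect (exists W, zPorada_legalI R S W KU).
  move=> [_ K0 _ oU [KsubU _]].
  by have [h [ch rh hK hU]] := zero_set_sub_open Zcompact K0 oU KsubU; exists h.
exists (cst 0); split; first exact: cst_continuous.
  by move=> _ [z _ <-] /=; rewrite in_itv/= lexx ler01.
by move=> W KUW; case: nleg; exists W.
Qed.

Let h KU := sval (cid (scale KU)).

Let h_continuous KU : continuous (h KU).
Proof. by rewrite /h; case: cid => ? []. Qed.

Let h_range KU : range (h KU) `<=` `[0, 1].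
Proof. by rewrite /h; case: cid => ? []. Qed.

Let h_legal KU W : zPorada_legalI R S W KU ->
  KU.1 = h KU @^-1` [set 0] /\ forall z, h KU z < 1 -> KU.2 z.
Proof. by rewrite /h; case: cid => ? [] /= _ _; apply. Qed.

Let h_ge0 KU z : 0 <= h KU z.
Proof. by have /= := h_range (imageT (h KU) z); rewrite in_itv => /andP[]. Qed.

(** The shift by 2 keeps the bound below 1 even for k = 0, so that the closed sublevel set also
    stays inside the open set of player I. *)
Let response KU k : set Z := [set z | h KU z < k.+2%:R^-1].

Let response_legal KU W k : zPorada_legalI R S W KU ->
  response KU k !=set0 /\ zPorada_legalII KU (response KU k).
Proof.
move=> KUW; have [KE hU] := h_legal KUW; have [[z Kz] _ _ _ _] := KUW.
have Kresp : KU.1 `<=` response KU k.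
  by rewrite KE => t /= ht; rewrite /response /= ht invr_gt0 ltr0n.
split; first by exists z; exact: Kresp.
split=> //.
  apply: (@open_comp _ _ (h KU) [set r | r < _]) => [t _|]; last exact: open_lt.
  exact: h_continuous.
by move=> t /lt_trans ht; apply: hU; apply: ht; rewrite invf_lt1 ?ltr0n// ltr1n.
Qed.

Let history (c : seq nat) :=
  foldl (fun s k => rcons s (response (sigma s) k)) [::] c.

Let history_rcons c k :
  history (rcons c k) = rcons (history c) (response (sigma (history c)) k).
Proof. by rewrite /history foldl_rcons. Qed.

Let history_admissible c : zPorada_admissible sigma (history c).
Proof.
elim/last_ind: c => [//|c k IH]; rewrite history_rcons.
have [? ?] := response_legal k (strat IH).
exact/zPorada_admissible_rcons.
Qed.

Let legal_history c :
  zPorada_legalI R S (last setT (history c)) (sigma (history c)).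
Proof. exact/strat/history_admissible. Qed.

Let hX_unit c : continuous (h (sigma (history c)) \o e) /\
  range (h (sigma (history c)) \o e) `<=` `[0, 1].
Proof.
split; last by move=> _ [x _ <-]; apply: h_range; exact: imageT.
move=> x; apply: continuous_comp; first exact: stone_cech_embed_continuous.
exact: h_continuous.
Qed.

(** Lists the functions of all positions; a number coding no position repeats the function of the
    empty one. *)
Let g (i : nat) : unit_function R X :=
  exist _ _ (hX_unit (odflt [::] (unpickle i))).

Let coordinates_pickle x c :
  point_coordinates (to_image g x) (pickle c) = h (sigma (history c)) (e x).
Proof.
(* Exposing [Some c] lets [pickleK] be rewritten backwards. *)
by rewrite -[RHS]/(h (sigma (history (odflt [::] (Some c)))) (e x)) -(pickleK c).
Qed.

(* Indexed by a position followed by II's answer there; [U [::]] is junk. *)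
Let U (c : seq nat) : set (metric_image g) :=
  [set y | (last 0%N c).+2%:R^-1 <
           point_coordinates y (pickle (take (size c).-1 c))].

Let U_rcons c k y :
  U (rcons c k) y = (k.+2%:R^-1 < point_coordinates y (pickle c)) :> Prop.
Proof. by rewrite /U /= last_rcons size_rcons/= -cats1 take_size_cat. Qed.

(** Covering holds because the zero-sets of player I miss X: each [h] is positive on X and so
    exceeds some 1/(k+2). *)
Let branch_exists : exists b : nat -> nat, forall y, exists n, U (mkseq b n.+1) y.
Proof.
apply: menger_branch; first exact: projectively_menger_metric_image.
- by move=> c; apply: open_superlevel => y; exact: point_coordinates_continuous.
- move=> c j k jk y; rewrite !U_rcons; apply: le_lt_trans.
  by rewrite lef_pV2 ?posrE ?ltr0n// ler_nat.
- move=> c y; have [x <-] := to_image_surj y.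
  have hx0 : 0 < h (sigma (history c)) (e x).
    rewrite lt_neqAle h_ge0 andbT eq_sym; apply/eqP => hx.
    have [_ _ KS _ _] := legal_history c; have [KE _] := h_legal (legal_history c).
    have [[_ nex] _] : (S `&` last setT (history c)) (e x) by apply: KS; rewrite KE.
    by apply: nex; exists x.
  have [k _ /(_ k (leqnn k)) /= kx] := near_infty_natSinv_lt (PosNum hx0).
  exists k; rewrite U_rcons coordinates_pickle; apply: le_lt_trans kx.
  by rewrite lef_pV2 ?posrE ?ltr0n// ler_nat.
Qed.

Lemma menger_beats_strategy : exists2 V : nat -> set Z, zPorada_run sigma V &
  zPorada_winsII S (fun n => (sigma (mkseq V n)).2).
Proof.
have [b bU] := branch_exists.
pose KU n := sigma (history (mkseq b n)).
pose V n := response (KU n) (b n).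
have mkseqV n : mkseq V n = history (mkseq b n).
  by elim: n => // n IH; rewrite !mkseqS history_rcons IH.
have legalKU n : zPorada_legalI R S (last setT (mkseq V n)) (KU n).
  by rewrite mkseqV; exact: legal_history.
have KUE : (fun n => (sigma (mkseq V n)).2) = (fun n => (KU n).2).
  by apply/funext => n; rewrite mkseqV.
exists V.
  by apply: zPorada_runS => n; rewrite mkseqV; exact: response_legal (legalKU n).
rewrite KUE; have USV n : (KU n.+1).2 `<=` V n.
  by have [_ _ _ _ []] := legalKU n.+1; rewrite mkseqS last_rcons.
(* These closed sets lie between the answer of II and the open set of I in the same inning, so
   compactness gives a common point. *)
pose C n := h (KU n) @^-1` [set r | r <= (b n).+2%:R^-1].
have VC n : V n `<=` C n by move=> z /ltW.
have CU n : C n `<=` (KU n).2.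
  have [_ hU] := h_legal (legalKU n).
  by move=> z /= Cz; apply/hU/(le_lt_trans Cz); rewrite invf_lt1 ?ltr0n// ltr1n.
split.
  have [|||z Cz] := @compact_bigcap_nonempty _ C Zcompact.
  - by move=> n; apply: closed_comp => [z _|]; [exact: h_continuous|exact: closed_le].
  - by move=> n; exact: (subset_trans (CU n.+1) (subset_trans (USV n) (VC n))).
  - by move=> n; have [[z ?] _] := response_legal (b n) (legalKU n); exists z; exact: VC.
  by exists z => n _; apply: CU; exact: Cz.
(* A point of X is covered at some stage [n] of the branch, where [h] exceeds the bound defining
   [V n]. *)
move=> z Uz; split=> // -[x _ xz].
have [n] := bU (to_image g x); rewrite mkseqS U_rcons coordinates_pickle xz.
by apply/negP; rewrite -leNgt; apply/ltW/USV/Uz.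
Qed.

End menger_beats_strategy.

(** * A winning strategy from covers without a finite selection *)

Section strategy_from_covers.
Context (R : realType) (X : topologicalType).
Local Notation Z := (stone_cech R X).
Local Notation e := (@stone_cech_embed R X).
Local Notation S := ([set: Z] `\` range e).
Context (g : nat -> nat -> unit_function R X).
Hypothesis g_cover : forall n x, exists k, 0 < sval (g n k) x.
Hypothesis g_not_menger : forall b : nat -> nat,
  exists x, forall n k, (k <= b n)%N -> sval (g n k) x = 0.

Let Zcompact := @stone_cech_compact R X.

Let extension n k : exists f : Z -> R,
  [/\ continuous f, range f `<=` `[0, 1] & f \o e = sval (g n k)].
Proof. by case: (g n k) => f [cf rf]; exact: stone_cech_extension. Qed.

Let G n k := sval (cid (extension n k)).

Let G_continuous n k : continuous (G n k).
Proof. by rewrite /G; case: cid => ? []. Qed.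

Let G_embed n k x : G n k (e x) = sval (g n k) x.
Proof. by rewrite /G; case: cid => f [/= _ _ <-]. Qed.

Let G01 n k z : 0 <= G n k z <= 1.
Proof.
suff : range (G n k) `<=` `[0, 1] by move=> /(_ _ (imageT _ z)) /=; rewrite in_itv.
by rewrite /G; case: cid => f [].
Qed.

Let zeros (P : set (nat * nat)) := \bigcap_(p in P) (G p.1 p.2 @^-1` [set 0]).

Let zeros_closed P : closed (zeros P).
Proof.
apply: closed_bigI => p _; apply: closed_comp => [z _|]; first exact: G_continuous.
exact: closed_eq.
Qed.

(** Pairs are coded by naturals, and functions indexed outside [P] are replaced by 0. *)
Let zeros_zero_set P : zero_set R (zeros P).
Proof.
pose u (z : Z) i := if unpickle i is Some p then
  if p \in P then G p.1 p.2 z else 0 else 0.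
suff -> : zeros P = [set z | forall i, u z i = 0].
  apply: zero_set_bigcap => [z i|i z].
    by rewrite /u; case: (unpickle _) => [p|]; [case: ifP|]; rewrite ?G01 ?lexx ?ler01.
  rewrite /u; case: (unpickle _) => [p|]; last exact: cst_continuous.
  by case: (p \in P); [exact: G_continuous|exact: cst_continuous].
apply/seteqP; split=> z /= zP => [i|p Pp].
  by rewrite /u; case: (unpickle _) => // p; case: ifPn => // /set_mem; exact: zP.
by have := zP (pickle p); rewrite /u pickleK mem_set.
Qed.

Let selected (c : seq nat) : set (nat * nat) :=
  [set p | (p.1 < size c)%N /\ (p.2 <= nth 0%N c p.1)%N].

(** The complete row [size c] keeps this set off X; earlier rows enter through finite pieces only,
    which leaves room for nonemptiness. *)
Let K (c : seq nat) := zeros (selected c `|` [set p | p.1 = size c]).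

Let selected_rcons c k : selected c `<=` selected (rcons c k).
Proof. by move=> p [pc pk]; split; rewrite ?size_rcons ?nth_rcons ?pc// ltnW. Qed.

Let zerosS P Q : P `<=` Q -> zeros Q `<=` zeros P.
Proof. by move=> PQ z zQ p /PQ; exact: zQ. Qed.

(** [K c] is the decreasing intersection over [k] of the closed sets on the right, so compactness
    applies. *)
Let K_sub_open c V : open V -> K c `<=` V ->
  exists k, zeros (selected (rcons c k)) `<=` V.
Proof.
move=> oV KV; apply: compact_bigcap_sub_open => //.
  move=> k; apply: zerosS => p [+ pk]; rewrite size_rcons => pc.
  split; rewrite ?size_rcons//; move: pk; rewrite !nth_rcons.
  by case: ifP => // _; case: ifP => // _ /leqW.
apply: subset_trans KV => z zc p [pc|pc].
  by apply: (zc 0%N); last exact: selected_rcons.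
apply: (zc p.2) => //; split; first by rewrite size_rcons pc.
by rewrite pc nth_rcons ltnn eqxx.
Qed.

(** Were it empty, finitely many functions would already have no common zero, against [g_not_menger]
    for [rcons c k] padded with zeros. *)
Let K_nonempty c : K c !=set0.
Proof.
apply/set0P/negP => /eqP K0.
have [|k k0] := K_sub_open (c := c) open0; first by rewrite K0.
have [x gx] := g_not_menger (nth 0%N (rcons c k)).
apply: (k0 (e x)) => p [_ pk].
by rewrite /= G_embed; exact: gx.
Qed.

Let K_sub_S c : K c `<=` S.
Proof.
move=> z Kz; split=> // -[x _ xz]; have [k gk] := g_cover (size c) x.
have := Kz (size c, k) (or_intror erefl).
by rewrite -xz /= G_embed => gk0; rewrite gk0 ltxx in gk.
Qed.

Let choice_of c (V : set Z) := xget 0%N [set k | zeros (selected (rcons c k)) `<=` V].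

Let choice_ofP c V : open V -> K c `<=` V ->
  zeros (selected (rcons c (choice_of c V))) `<=` V.
Proof. by move=> oV KV; exact: (xgetPex 0%N (K_sub_open oV KV)). Qed.

Let choices (s : seq (set Z)) := foldl (fun c V => rcons c (choice_of c V)) [::] s.

Let choices_rcons s V : choices (rcons s V) = rcons (choices s) (choice_of (choices s) V).
Proof. by rewrite /choices foldl_rcons. Qed.

(** The open set is the last answer of II unchanged; II is constrained through [K] alone. *)
Let sigma (s : seq (set Z)) : set Z * set Z := (K (choices s), last setT s).

Let admissible_last s : zPorada_admissible sigma s ->
  open (last setT s) /\ zeros (selected (choices s)) `<=` last setT s.
Proof.
case/lastP: s => [|s V]; first by split; first exact: openT.
move=> /zPorada_admissible_rcons[_ _ [oV KV _]].
by rewrite last_rcons choices_rcons; split=> //; exact: choice_ofP.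
Qed.

(** The indices read off along a run form a sequence [b]. The point of X that [g_not_menger] gives
    for [b] survives in every open set played, so the intersection is not inside [S]. *)
Lemma strategy_from_covers : exists sigma, zPorada_winning_strategy R S sigma.
Proof.
exists sigma; split=> [s adm|V runV [_ capS]].
  have [oV zV] := admissible_last adm.
  have KV : K (choices s) `<=` last setT s.
    by apply: subset_trans zV; apply: zerosS; exact: subsetUl.
  split=> /=; [exact: K_nonempty|exact: zeros_zero_set| |exact: oV|by split].
  by move=> z Kz; split; [exact: K_sub_S Kz|exact: KV].
pose b n := choice_of (choices (mkseq V n)) (V n).
have choicesE n : choices (mkseq V n) = mkseq b n.
  by elim: n => // n IH; rewrite !mkseqS choices_rcons -IH.
have [x gx] := g_not_menger b.
have [_] : S (e x); last by apply; exists x.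
apply: capS => n _; have [_] := admissible_last (runV n); apply.
rewrite choicesE => p [+ pb]; rewrite size_mkseq => pn.
by rewrite /= G_embed; apply: gx; rewrite nth_mkseq in pb.
Qed.

End strategy_from_covers.

(** * From covers of a metric image to functions on X *)

Lemma separable_enum (Y : topologicalType) : separable Y ->
  [set: Y] = set0 \/ exists d : nat -> Y, dense (range d).
Proof.
move=> [D /pfcard_geP[D0|[d]] denseD]; [left|right].
  apply/seteqP; split=> // y _.
  by have [|z [_]] := denseD setT _ openT; [exists y|rewrite D0].
exists d => O O0 oO; have [z [Oz Dz]] := denseD O O0 oO; exists z; split=> //.
by have [n _ <-] := @surj _ _ _ _ d z Dz; exists n.
Qed.

(** Each cover is refined by countably many balls around a dense sequence. These are cozero-sets of
    bump functions, which pull back to X. *)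
Lemma projectively_menger_of_covers (R : realType) (X : topologicalType) :
  (forall g : nat -> nat -> unit_function R X,
    (forall n x, exists k, 0 < sval (g n k) x) ->
    exists b : nat -> nat, forall x, exists n k, (k <= b n)%N /\ sval (g n k) x != 0) ->
  projectively_menger R X.
Proof.
move=> XC Y f sepY cf fY W Wcover.
have [Y0|[d dense_d]] := separable_enum sepY.
  exists (fun=> set0); split; first by split; [exact: finite_set0|exact: sub0set].
  by apply/seteqP; split=> // y; rewrite Y0.
pose r m : R := m.+1%:R^-1.
have r0 m : 0 < r m by rewrite invr_gt0 ltr0n.
pose good n (p : nat * nat) O := W n O /\ ball (d p.1) (r p.2) `<=` O.
pose bump (p : nat * nat) (y : Y) := Num.max 0 (r p.2 - mdist (d p.1) y).
have bump_continuous p : continuous (bump p).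
  apply: (@continuous_mdist_bound _ _ _ 1) => // y z; rewrite mul1r.
  have := metric_triangle (d p.1) y z; have := metric_triangle (d p.1) z y.
  have := mdist_ge0 y z; rewrite (metric_sym z y) /bump => yz0 dzy dyz.
  rewrite ler_norml; apply/andP; split;
    rewrite /Num.max; case: ltP => ?; case: ltP => ?; lra.
(* Balls contained in no member of the cover get the zero function and are thus never selected. *)
pose u n k y : R := if unpickle k is Some p then
  if `[<exists O, good n p O>] then bump p y else 0 else 0.
have uf n k : continuous (u n k \o f) /\ range (u n k \o f) `<=` `[0, 1].
  split.
    move=> x; apply: continuous_comp; first exact: cf.
    rewrite /u; case: (unpickle _) => [p|]; last exact: cst_continuous.
    by case: `[<_>]; [exact: bump_continuous|exact: cst_continuous].
  move=> _ [x _ <-] /=; rewrite in_itv/= /u.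
  case: (unpickle _) => [p|]; last by rewrite lexx ler01.
  case: ifP => _; last by rewrite lexx ler01.
  rewrite /bump le_max lexx/= ge_max ler01/=.
  rewrite lerBlDr (@le_trans _ _ 1)//; last by rewrite lerDl mdist_ge0.
  by rewrite invf_le1 ?ltr0n// ler1n.
have [|b bX] := XC (fun n k => exist _ _ (uf n k)).
  move=> n x; have [oW Wx] := Wcover n.
  have [A WA Afx] : (\bigcup_(A in W n) A) (f x) by rewrite Wx.
  have : nbhs (f x) A by apply: open_nbhs_nbhs; split=> //; exact: oW.
  rewrite -metricType_numDomainType.filter_from_mdist_nbhs => -[eps /= eps0 fxA].
  (* A ball of radius below eps/2 whose centre is that close to [f x] lies within eps of [f x],
     hence in [A]. *)
  have eps20 : 0 < eps / 2 by rewrite divr_gt0.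
  have [m _ /(_ m (leqnn m)) /= me] := near_infty_natSinv_lt (PosNum eps20).
  have [||y [By [i _ iy]]] := dense_d (ball (f x) (r m))^°.
  - exists (f x); apply: nbhsx_ballx; exact: r0.
  - exact: open_interior.
  have {By} := interior_subset By; rewrite ballEmdist /= -iy => dx.
  exists (pickle (i, m)); rewrite /= /u pickleK ifT.
    by rewrite /bump lt_max subr_gt0/= metric_sym dx orbT.
  apply/asboolP; exists A; split=> // z; rewrite ballEmdist /= => dz.
  apply: fxA => /=; apply: (le_lt_trans (metric_triangle _ (d i) _)).
  by move: me dx dz; rewrite -/(r m); lra.
pose O n k : set Y := xget set0 [set O | good n (odflt (0, 0)%N (unpickle k)) O].
(* Membership in [W n] is required since [O n k] may be the default [set0]. *)
exists (fun n => O n @` [set k | (k <= b n)%N /\ W n (O n k)]); split.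
  move=> n; split; last by move=> _ [k [_ WO] <-].
  apply: finite_image; apply: (@sub_finite_set _ _ `I_(b n).+1) => [k []//|].
  exact: finite_II.
apply/seteqP; split=> // y _; have [x _ xy] : range f y by rewrite fY.
have [n [k [kb]]] := bX x; rewrite /= xy /u.
case kp : (unpickle k) => [p|]; last by rewrite eqxx.
case: asboolP => [pgood|_]; last by rewrite eqxx.
have [WO dO] : good n p (O n k) by rewrite /O kp; exact: (xgetPex set0 pgood).
move=> bump0; exists (O n k); first by exists n => //; exists k.
apply: dO; rewrite ballEmdist /= ltNge; apply: contra bump0 => rd.
by rewrite /bump max_l// subr_le0.
Qed.

Local Close Scope ring_scope.

Theorem theorem4p3 (R : realType) (X : topologicalType)
    (hX : tychonoff_space X) :
  projectively_menger R X <->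
  ~ (exists sigma : seq (set (stone_cech R X)) ->
                    set (stone_cech R X) * set (stone_cech R X),
       zPorada_winning_strategy R
         ([set: stone_cech R X] `\` range (@stone_cech_embed R X)) sigma).
Proof.
split=> [pmX [sigma [strat win]]|nowin].
  by have [V runV] := menger_beats_strategy strat pmX; exact: win.
apply: projectively_menger_of_covers => g g_cover; apply: contrapT => nob.
apply: nowin; apply: (strategy_from_covers g_cover) => b.
have /existsNP[x /forallNP xb] := (forallNP _).2 nob b.
exists x => n k kb; apply/eqP/negPn/negP => gx.
by apply: (xb n); exists k.
Qed.
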